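(* Let $f:[0,1)\to[0,1)$ be a piecewise increasing contraction with exactly $n$ discontinuity points, and let $\ell$ be the number of discontinuity points of $f$ whose image under $f$ equals $0$. Then $f$ has at most $n+1-\ell$ periodic orbits.
   Context: Let $I=[0,1)$. A map $f:I\to I$ is called a piecewise increasing contraction if it is continuous except at finitely many points, it is right continuous at every discontinuity point, and there exists $0<\lambda<1$ such that on every domain of continuity $D$ of $f$ (interval between consecutive discontinuities) the restriction $f|_D$ is strictly increasing and $\lambda$-Lipschitz, i.e. $|f(x)-f(y)|\le\lambda|x-y|$ for all $x,y\in D$. A periodic orbit is the forward orbit of a periodic point of $f$. *)

(* Defs.v *)
From HB Require Import structures.
From mathcomp Require Import all_boot all_order all_algebra.
From mathcomp Require Import all_classical all_reals all_analysis.
Set Implicit Arguments.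
Unset Strict Implicit.
Unset Printing Implicit Defensive.
Import Order.TTheory GRing.Theory Num.Theory.
Import numFieldNormedType.Exports.
Local Open Scope classical_set_scope.
Local Open Scope ring_scope.

(* A map [0,1) -> [0,1) is represented by f : R -> R preserving [0,1); no
   definition below depends on the values of f outside [0,1). *)
Definition I01 {R : realType} : set R := `[0, 1[%classic.

(* Continuity is relative to [0,1): at 0 only the right-hand limit counts. *)
Definition discontinuities (R : realType) (f : R -> R) : set R :=
  [set x | I01 x /\ ~ (f @ within I01 (nbhs x) --> f x)].

(* For discontinuities x_1 < ... < x_n of f, the domains of continuity are
   [0, x_1), [x_1, x_2), ..., [x_n, 1). *)
Definition continuity_domain (R : realType) (f : R -> R) (D : set R) : Prop :=
  exists a b : R,
    [/\ a < b, a = 0 \/ discontinuities f a, b = 1 \/ discontinuities f b,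
        forall x, a < x < b -> ~ discontinuities f x
      & D = `[a, b[%classic].

Definition piecewise_increasing_contraction (R : realType) (f : R -> R) : Prop :=
  [/\ set_fun I01 I01 f,
      finite_set (discontinuities f),
      forall x, discontinuities f x -> f @ x^'+ --> f x
    & exists2 lambda : R, 0 < lambda < 1 &
        forall D, continuity_domain f D ->
          {in D &, {homo f : x y / x < y}} /\
          lambda.-lipschitz_D f].

Definition forward_orbit (R : realType) (f : R -> R) (x : R) : set R :=
  range (fun k : nat => iter k f x).

Definition periodic_point (R : realType) (f : R -> R) (x : R) : Prop :=
  I01 x /\ exists2 p : nat, (0 < p)%N & iter p f x = x.

Definition periodic_orbits (R : realType) (f : R -> R) : set (set R) :=
  forward_orbit f @` periodic_point f.

(* Main.v *)
Require Import Defs.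
From HB Require Import structures.
From mathcomp Require Import all_boot all_order all_algebra.
From mathcomp Require Import all_classical all_reals all_analysis.
From mathcomp Require Import finmap lra.
Import Order.TTheory GRing.Theory Num.Theory.
Import numFieldNormedType.Exports.
Local Open Scope classical_set_scope.
Local Open Scope ring_scope.
Local Open Scope card_scope.

(* Let x be the point of a periodic orbit O that is closest to the left endpoint
   a of its domain of continuity, at distance d. Then [z - d, z] stays inside one
   domain for every z in O, so f, being increasing and contracting there, maps
   these intervals into one another, and the orbit of a is attracted by O. Every
   periodic orbit thus attracts some a in {0} \cup D, where D is the set of
   discontinuities, and a point is attracted by at most one periodic orbit. A
   discontinuity a with f a = 0 is attracted by the same periodic orbit as 0, so
   the l such discontinuities can be discarded. *)

Lemma seq_argmax (R : realType) (T : eqType) (F : T -> R) (s : seq T) (x0 : T) :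
  x0 \in s -> exists2 x, x \in s & forall y, y \in s -> F y <= F x.
Proof.
elim: s x0 => // a [|b s] IH x0 _.
  by exists a; rewrite ?mem_head// => y; rewrite mem_seq1 => /eqP ->.
have [x xs xmax] := IH b (mem_head _ _).
have [Fxa|/ltW Fax] := leP (F x) (F a).
- exists a; rewrite ?mem_head// => y; rewrite in_cons => /predU1P[->//|/xmax Fyx].
  exact: le_trans Fyx Fxa.
- by exists x => [|y]; rewrite in_cons ?xs ?orbT// => /predU1P[->|/xmax].
Qed.

(** Take [a] as the largest element [<= z] among [0] and the finitely many discontinuities, and [b]
    as the smallest element [> z] among [1] and the discontinuities. *)
Lemma continuity_domain_ex {R : realType} {f : R -> R} {z : R} :
  finite_set (discontinuities f) -> I01 z ->
  exists a b : R, [/\ a = 0 \/ discontinuities f a,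
    0 <= a, a <= z < b & continuity_domain f `[a, b[%classic].
Proof.
move=> /finite_seqP[s Ds]; rewrite /I01 /= in_itv/= => /andP[z0 z1].
have inD c : (c \in s) = `[< discontinuities f c >].
  by apply/idP/asboolP; rewrite Ds.
have [|a] := @seq_argmax R R id [seq c <- 0 :: s | c <= z] 0.
  by rewrite mem_filter z0 mem_head.
rewrite mem_filter in_cons inD => /andP[az /predU1P a0D] amax.
have [|b] := @seq_argmax R R -%R [seq c <- 1 :: s | z < c] 1.
  by rewrite mem_filter z1 mem_head.
rewrite mem_filter in_cons inD => /andP[zb /predU1P b1D] bmin.
have aP : a = 0 \/ discontinuities f a by case: a0D => [|/asboolP]; [left|right].
have bP : b = 1 \/ discontinuities f b by case: b1D => [|/asboolP]; [left|right].
exists a, b; split => //; last 2 first.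
- by rewrite az.
- exists a, b; split => //; first exact: le_lt_trans zb.
  move=> x /andP[ax xb] /asboolP; rewrite -inD => xs.
  have [xz|zx] := leP x z.
    by have := amax x; rewrite mem_filter xz in_cons xs orbT leNgt ax => /(_ isT).
  by have := bmin x; rewrite mem_filter zx in_cons xs orbT lerN2 leNgt xb => /(_ isT).
- by apply: amax; rewrite mem_filter z0 mem_head.
Qed.

Lemma iter_period {T : Type} {g : T -> T} {x : T} {p : nat} (k : nat) :
  iter p g x = x -> iter (p * k) g x = x.
Proof. by move=> gx; elim: k => [|k IH]; rewrite ?muln0// mulnS iterD IH. Qed.

Lemma forward_orbit_iter {R : realType} {f : R -> R} {x : R} (j : nat) :
  periodic_point f x -> forward_orbit f (iter j f x) = forward_orbit f x.
Proof.
move=> [_ [p p0 fx]]; apply/seteqP; split => _ [k _ <-].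
  by exists (k + j)%N; rewrite ?iterD.
(* Advancing [iter j f x] by [p * j - j] steps completes [j] full periods and returns to [x]. *)
exists (k + (p * j - j))%N => //.
by rewrite -iterD -addnA subnK ?leq_pmull// iterD iter_period.
Qed.

Lemma iter_I01 {R : realType} {f : R -> R} {x : R} (k : nat) :
  set_fun I01 I01 f -> I01 x -> I01 (iter k f x).
Proof. by move=> fI Ix; elim: k => //= k; apply: fI. Qed.

Lemma periodic_point_iter {R : realType} {f : R -> R} {x : R} (j : nat) :
  set_fun I01 I01 f -> periodic_point f x -> periodic_point f (iter j f x).
Proof.
move=> fI [Ix [p p0 fx]]; split; first exact: iter_I01.
by exists p; rewrite // -iterD addnC iterD fx.
Qed.

(** The orbits are compared at equal times, so the phase of [x] along its orbit matters. No
    multiplicative constant is required because [[0, 1)] has length 1. *)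
Definition attracted (R : realType) (f : R -> R) (lambda a x : R) : Prop :=
  forall k : nat, `|iter k f a - iter k f x| <= lambda ^+ k.

(** At times [p * q * m], common multiples of both periods, [x] and [y] have both returned to
    themselves while the orbit of [a] is close to each. Their distance is thus at most
    [2 * lambda ^+ m] for every [m]. *)
Lemma attracted_unique {R : realType} {f : R -> R} {lambda a x y : R} :
  0 < lambda < 1 -> periodic_point f x -> periodic_point f y ->
  attracted R f lambda a x -> attracted R f lambda a y -> x = y.
Proof.
move=> /andP[l0 l1] [_ [p p0 fx]] [_ [q q0 fy]] ax ay.
apply/eqP; rewrite -subr_eq0 -normr_le0.
have le_xy m : `|x - y| <= 2 * lambda ^+ m.
  have pqm : (m <= p * q * m)%N by rewrite leq_pmull// muln_gt0 p0.
  have := ax (p * q * m)%N; have := ay (p * q * m)%N.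
  have -> : iter (p * q * m) f x = x by rewrite -mulnA iter_period.
  have -> : iter (p * q * m) f y = y by rewrite (mulnC p) -mulnA iter_period.
  move: (iter _ _ _) => w wy wx.
  apply: (@le_trans _ _ (2 * lambda ^+ (p * q * m))).
    rewrite distrC in wx; apply: le_trans (ler_distD w x y) _.
    by rewrite mulr_natl mulr2n lerD.
  by rewrite ler_pM2l// ler_wiXn2l// ltW.
have cvg0 : (fun m => 2 * lambda ^+ m) @ \oo --> (0 : R).
  rewrite -[X in _ --> X](mulr0 2); apply: cvgMr; apply: cvg_expr.
  by rewrite gtr0_norm.
rewrite -(cvg_lim _ cvg0)//; apply: limr_ge; first by apply/cvg_ex; exists 0.
exact: nearW.
Qed.

Lemma left_endpoint_attracted {R : realType} {f : R -> R} {lambda x : R} :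
  set_fun I01 I01 f -> finite_set (discontinuities f) -> 0 < lambda < 1 ->
  (forall D, continuity_domain f D ->
     {in D &, {homo f : x y / x < y}} /\ lambda.-lipschitz_D f) ->
  periodic_point f x ->
  exists (a : R) (j : nat), (a = 0 \/ discontinuities f a) /\
    attracted R f lambda a (iter j f x).
Proof.
move=> fI finD /andP[l0 l1] fD [Ix [p p0 fx]].
have /choice[L LP] : forall z, exists a, I01 z -> exists b : R,
    [/\ a = 0 \/ discontinuities f a,
    0 <= a, a <= z < b & continuity_domain f `[a, b[%classic].
  move=> z; have [Iz|nIz] := pselect (I01 z); last by exists 0.
  by have [a [b ab]] := continuity_domain_ex finD Iz; exists a => _; exists b.
pose d j := iter j f x - L (iter j f x).
(* Maximising [- d] over one period minimises [d]; periodicity then makes [d j] minimal over all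
   times. *)
have [|j _ jmin] := @seq_argmax R nat (fun j => - d j) (iota 0 p) 0%N.
  by rewrite mem_iota.
have dmin i : d j <= d i.
  have -> : d i = d (i %% p)%N.
    rewrite /d {1 2}(divn_eq i p) addnC mulnC iterD.
    by rewrite iter_period.
  by rewrite -lerN2; apply: jmin; rewrite mem_iota add0n ltn_mod p0.
have Iy := iter_I01 j fI Ix.
have [b [ya y0 /andP[yL yb] _]] := LP _ Iy.
exists (L (iter j f x)), j; split => //.
have d0 : 0 <= d j by rewrite subr_ge0.
have d1 : d j <= 1.
  by move: Iy; rewrite /d /I01 /= in_itv/= => /andP[_ ?]; lra.
(* The induction also carries the sign: the orbit of the endpoint stays to the left of the periodic
   one, so only left endpoints can separate them. *)
suff key k : 0 <= iter k f (iter j f x) - iter k f (L (iter j f x))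
                 <= lambda ^+ k * d j.
  move=> k; have /andP[k0 kd] := key k.
  rewrite distrC ger0_norm//; apply: le_trans kd _.
  by rewrite -[leRHS]mulr1 ler_wpM2l// exprn_ge0// ltW.
elim: k => [|k /andP[]]; first by rewrite expr0 mul1r /= lexx andbT.
have [c [_ _ /andP[Lz zc] Dz]] := LP _ (iter_I01 k fI Iy).
have := dmin (k + j)%N; rewrite /d iterD /= -/(d j).
move: Lz zc Dz.
set z := iter k f _; set w := iter k f (L _) => Lz zc Dz dz w0 wd.
(* By minimality [d j <= z - L z], so this bound gives [L z <= w <= z]: both points lie in the
   domain of [z], where [f] is increasing and contracting. *)
have wdj : z - w <= d j.
  apply: le_trans wd _; rewrite -[leRHS]mul1r ler_wpM2r//.
  by rewrite exprn_ile1// ltW.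
have wz : w <= z by rewrite -subr_ge0.
have [inc lip] := fD _ Dz.
have zD : `[L z, c[%classic z by rewrite /= in_itv/= Lz zc.
have wD : `[L z, c[%classic w.
  by rewrite /= in_itv/= (le_lt_trans wz zc) andbT; lra.
have fwz : f w <= f z.
  move: wz; rewrite le_eqVlt => /predU1P[->//|wz].
  by apply/ltW/inc => //; apply/mem_set.
rewrite subr_ge0 fwz /= exprS -mulrA.
have := lip (z, w) (conj zD wD); rewrite /= !ger0_norm ?subr_ge0// => lipzw.
by apply: le_trans lipzw _; rewrite ler_pM2l.
Qed.

Lemma card_setU1D_le {T : choiceType} {A B : set T} {n l : nat} (x : T) :
  B `<=` A -> A #= `I_n -> B #= `I_l -> x |` (A `\` B) #<= `I_(n + 1 - l)%N.
Proof.
move=> BA An Bl.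
have fA : finite_set A by apply/finite_setP; exists n.
have fB : finite_set B by apply/finite_setP; exists l.
have fAB : finite_set (A `\` B) by exact: finite_setD.
have fU : finite_set (x |` (A `\` B)) by rewrite finite_setU; split.
have subBA : (fset_set B `<=` fset_set A)%fset by rewrite -fset_set_sub.
have /finite_setP[m Um] := fU.
rewrite (card_le_eql Um) card_le_II -(card_fset_set Um).
rewrite fset_setU1// fset_setD// cardfsU1.
rewrite cardfsDS// (card_fset_set An) (card_fset_set Bl).
have ln : (l <= n)%N.
  by rewrite -(card_fset_set An) -(card_fset_set Bl) fsubset_leq_card.
by rewrite addnC -addnBAC// leq_add2l leq_b1.
Qed.

Theorem theorem1 (R : realType) (f : R -> R) (n l : nat)
  (hf : piecewise_increasing_contraction f)
  (hn : discontinuities f #= `I_n)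
  (hl : [set x | discontinuities f x /\ f x = 0] #= `I_l) :
  periodic_orbits f #<= `I_(n + 1 - l)%N.
Proof.
have [fI finD _ [lambda l01 fD]] := hf.
apply: card_le_trans (card_setU1D_le 0 _ hn hl); last by move=> x [].
pose basin a := [set x | periodic_point f x /\ attracted R f lambda a x].
(* The default [0] is harmless when [basin a] is empty: [h] only has to reach every periodic
   orbit. *)
pose h a := forward_orbit f (xget 0 (basin a)).
apply: card_le_trans (card_image_le h _).
apply: subset_card_le => _ [x Px <-].
suff [a [j [aA aj]]] : exists a j,
    (0 |` (discontinuities f `\`
      [set x | discontinuities f x /\ f x = 0])) a /\
    attracted R f lambda a (iter j f x).
  exists a => //; rewrite /h -(forward_orbit_iter j Px); congr forward_orbit.
  have [Py ay] : basin a (xget 0 (basin a)).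
    by apply: (xgetI _ (x := iter j f x)); split=> //; apply: periodic_point_iter.
  by apply: (attracted_unique l01 Py _ ay aj); apply: periodic_point_iter.
have [a [j [aD aj]]] := left_endpoint_attracted fI finD l01 fD Px.
have [[Da fa0]|nZ] := pselect (discontinuities f a /\ f a = 0).
  (* As [f a = 0], the orbit of [0] is that of [a] one step later, hence the shift to [j.+1]; the
     bound [lambda ^+ k.+1] is even stronger than required. *)
  exists 0, j.+1; split; first by left.
  move=> k; have := aj k.+1; rewrite iterSr fa0 iterSr -iterS => /le_trans; apply.
  by case/andP: l01 => l0 l1; rewrite ler_wiXn2l// ltW.
by exists a, j; split=> //; case: aD => [->|Da]; [left|right; split].
Qed.
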